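(* Let $n\ge1$. The connectivity locus $\mathcal{C}_n$ of the family $Pol_n$ is compact. Moreover, all the connected filled-in Julia sets $K(p)$, $p\in\mathcal{C}_n$, are contained in a uniform (common bounded) neighborhood of $0$.
   Context: $Pol_n$ is the set of polynomials of the form $P_{a_n}\circ\dots\circ P_{a_1}$ with $P_a(z)=z^2+a$, $(a_1,\dots,a_n)\in\mathbb{C}^n$, topologized as a subset of the space of polynomials of degree $2^n$ (coefficients). The filled-in Julia set $K(p)$ is the set of points with bounded forward orbit. The connectivity locus $\mathcal{C}_n$ is the set of $p\in Pol_n$ with $K(p)$ connected. *)

(* Defs.v *)
From mathcomp Require Import all_boot all_order all_algebra.
From mathcomp Require Import complex.
From mathcomp Require Import all_classical all_reals all_analysis.

Set Implicit Arguments.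
Unset Strict Implicit.
Unset Printing Implicit Defensive.

Import Order.TTheory GRing.Theory Num.Theory.
Import numFieldNormedType.Exports.

Local Open Scope classical_set_scope.
Local Open Scope ring_scope.
Local Open Scope complex_scope.

(* R[i] carries no topology by itself; packing it as a numClosedFieldType makes
   the norm topology of numFieldNormedType available. *)
Definition Cplx (R : realType) : numClosedFieldType := R[i].

Section Dynamics.
Context {R : realType}.
Local Notation C := (Cplx R).
Implicit Types (n : nat) (p : {poly C}).

(* [:: a_1; ...; a_n] |-> P_{a_n} o ... o P_{a_1}, where P_a(z) = z^2 + a *)
Definition quad_comp (a : seq C) : {poly C} :=
  foldl (fun p c => ('X^2 + c%:P) \Po p) 'X a.

Definition Pol n : set {poly C} :=
  [set quad_comp a | a in [set: n.-tuple C]].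

Definition forward_orbit p (z : C) : set C :=
  range (fun k : nat => iter k (horner p) z).

Definition filled_julia p : set C := [set z | bounded_set (forward_orbit p z)].

Definition connectivity_locus n : set {poly C} :=
  [set p | Pol n p /\ connected (filled_julia p)].

(* Polynomials of degree at most 2 ^ n are topologized by their coefficients:
   coefs n is a bijection from them to the row vectors of size 2 ^ n + 1. *)
Definition coefs n p : 'rV[C]_(2 ^ n).+1 := poly_rV p.

End Dynamics.

(* Main.v *)
Require Import Defs.
From mathcomp Require Import all_boot all_order all_algebra.
From mathcomp Require Import complex.
From mathcomp Require Import all_classical all_reals all_analysis.
From mathcomp Require Import ring lra.
Import Order.TTheory GRing.Theory Num.Theory.
Import numFieldNormedType.Exports.
Local Open Scope classical_set_scope.
Local Open Scope ring_scope.
Local Open Scope complex_scope.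

(* Let a_0, a_1, ... be the n-periodic sequence of coefficients of
   p = P_{a_n} o ... o P_{a_1}, and let K_j be the set of points with bounded orbit
   under P_{a_j}, P_{a_(j+1)}, ...; thus K_0 = K(p), K_(j+1) = P_{a_j}(K_j) and
   K_j is the preimage of K_(j+1). K(p) is connected if and only if 0 lies in every
   K_j.
   If the critical value a_j is off K_(j+1), then K_j splits into two opposite
   halves: the points b off K = K_(j+1) for which the preimage of K under
   z^2 + b splits in this way form a relatively clopen subset of the complement of
   K, which contains all large b, and by the maximum principle the complement of K
   has no bounded relatively clopen part. Conversely, if 0 is in every K_j then
   K(p) is a nested intersection of compact sets obtained from a disc by
   successive connected preimages.
   When all the critical orbits are bounded, an index j maximizing |a_j| shows
   that |a_i| <= 2 for all i, for otherwise the orbit of 0 from time j escapes.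
   All the K_j and all the critical orbits then lie in the disc of radius 2, and
   "all critical orbits stay in this disc" is a closed condition on
   (a_1, ..., a_n). *)

(** * Real-valued modulus on the complex numbers *)

Section Modulus.
Context {R : realType}.
Local Notation C := (Cplx R).

(** The norm of [C] takes its values in [C]; its real part lives in the ordered field [R], where
    [lra] and [nra] apply. *)
Definition md (z : C) : R := complex.Re (`|z| : R[i]).

Lemma mdE (z : C) : `|z| = (md z)%:C :> R[i].
Proof.
have : `|z| \is Num.real by rewrite ger0_real.
by move=> /complex_realP[k]; rewrite /md => ->.
Qed.

Lemma md_ge0 z : 0 <= md z.
Proof. by have := normr_ge0 z; rewrite mdE ler0c. Qed.

Lemma md_eq0 z : (md z == 0) = (z == 0).
Proof.
by rewrite -[RHS]normr_eq0 mdE -(inj_eq (@complexI R)).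
Qed.

Lemma mdM z w : md (z * w) = md z * md w.
Proof. by apply: (@complexI R); rewrite rmorphM/= -!mdE normrM. Qed.

Lemma mdX z k : md (z ^+ k) = md z ^+ k.
Proof. by apply: (@complexI R); rewrite rmorphXn/= -!mdE normrX. Qed.

Lemma mdN z : md (- z) = md z.
Proof. by rewrite /md normrN. Qed.

Lemma mdB z w : md (z - w) = md (w - z).
Proof. by rewrite -mdN opprB. Qed.

Lemma md_triangle z w : md (z + w) <= md z + md w.
Proof. by rewrite -lecR rmorphD/= -!mdE ler_normD. Qed.

Lemma md0 : md 0 = 0. Proof. by apply/eqP; rewrite md_eq0. Qed.

Lemma md_real (x : R) : md x%:C = `|x|.
Proof. by rewrite /md normc_def /= expr0n /= addr0 sqrtr_sqr. Qed.

Lemma ball_md (x y : C) (e : R) : ball x e%:C y <-> md (x - y) < e.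
Proof. by rewrite -ball_normE /ball_ /= mdE ltcR. Qed.

Lemma nbhs_md (x : C) (A : set C) :
  nbhs x A <-> exists2 e : R, 0 < e & forall y, md (x - y) < e -> A y.
Proof.
split=> [/nbhs_ballP[e /= e0 eA]|[e e0 eA]].
  have er : (complex.Re e)%:C = e by apply: RRe_real; exact: gtr0_real.
  exists (complex.Re e); first by rewrite -ltcR er.
  by move=> y /ball_md; rewrite er; exact: eA.
apply/nbhs_ballP; exists e%:C; first by rewrite /= ltcR.
by move=> y /ball_md; exact: eA.
Qed.

End Modulus.

(** * Compactness of discs and cluster points of bounded sequences *)

Section Topology.
Context {R : realType}.
Local Notation C := (Cplx R).

Lemma md_sub_abs (z w : C) : `|md z - md w| <= md (z - w).
Proof.
have h1 := md_triangle (z - w) w; have h2 := md_triangle (w - z) z.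
rewrite !subrK in h1 h2; rewrite mdB in h2.
by rewrite ler_norml; lra.
Qed.

Lemma md_continuous : continuous (@md R).
Proof.
move=> z A /nbhs_ballP[e /= e0 eA]; apply/nbhs_md; exists e => // y zy.
apply: eA; rewrite -ball_normE /=; exact: le_lt_trans (md_sub_abs _ _) zy.
Qed.

Lemma closed_md_le (T : topologicalType) (f : T -> C) r :
  continuous f -> closed [set x | md (f x) <= r].
Proof.
move=> cf; apply: (@closed_comp _ _ (fun x => md (f x)) [set y | y <= r]).
  by move=> x _; apply: continuous_comp; [exact: cf | exact: md_continuous].
exact: closed_le.
Qed.

Lemma disc_closed r : closed [set z : C | md z <= r].
Proof. by apply: (@closed_md_le C id) => z. Qed.

Lemma md_Re_Im (x y : R) : md (x +i* y) <= `|x| + `|y|.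
Proof.
have -> : (x +i* y : C) = x%:C + 'i%C * y%:C by rewrite [LHS]complexE.
apply: le_trans (md_triangle _ _) _; rewrite mdM !md_real.
by rewrite [md 'i%C]/md normc_def /= expr0n expr1n /= add0r sqrtr1 mul1r.
Qed.

Lemma disc_compact (r : R) : compact [set z : C | md z <= r].
Proof.
pose f (p : R * R) : C := p.1 +i* p.2.
have cf : continuous f.
  move=> [x y] A /nbhs_md[e e0 eA]; have r0 : 0 < e / 2 by rewrite divr_gt0.
  exists (ball x (e / 2), ball y (e / 2)).
    by split; exact: nbhsx_ballx.
  move=> [x' y']; rewrite -!ball_normE /= => -[xx yy]; apply: eA.
  have -> : f (x, y) - f (x', y') = (x - x') +i* (y - y') by [].
  by rewrite (le_lt_trans (md_Re_Im _ _))// [ltRHS]splitr ltrD.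
have := continuous_compact (continuous_subspaceT cf)
  (compact_setX (@segment_compact R (- r) r) (@segment_compact R (- r) r)).
move=> cE; apply: (subclosed_compact _ cE).
  exact: disc_closed.
move=> [x y] /= h; exists (x, y) => //=; rewrite !in_itv /= -!ler_norml.
have hx (u v : R) : `|u| <= Num.sqrt (u ^+ 2 + v ^+ 2).
  by rewrite -sqrtr_sqr ler_wsqrtr // lerDl sqr_ge0.
rewrite /md normc_def /= in h.
by split; apply: le_trans h; rewrite ?hx // addrC hx.
Qed.

Lemma bounded_closed_compact_md (E : set C) r :
  closed E -> (forall z, E z -> md z <= r) -> compact E.
Proof. by move=> cE Er; apply: (subclosed_compact cE (disc_compact r)). Qed.

Lemma bounded_seq_cluster (u : nat -> C) r : (forall k, md (u k) <= r) ->
  exists x, forall e N, 0 < e -> exists2 k, (N <= k)%N & md (x - u k) < e.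
Proof.
move=> ur; have [|x [_ cx]] := disc_compact r (u @ \oo) _.
  by exists 0%N => // k _; exact: ur.
exists x => e N e0.
have [| |_ [[k Nk <-]]] := cx [set u k | k in [set k | (N <= k)%N]]
  [set y | md (x - y) < e] _ _; last by exists k.
- by exists N => // k Nk; exists k.
- by apply/nbhs_md; exists e.
Qed.

Lemma closed_seq_cluster (E : set C) (u : nat -> C) x : closed E ->
  (forall k, E (u k)) -> (forall e, 0 < e -> exists k, md (x - u k) < e) -> E x.
Proof.
move=> cE Eu xu; apply: cE => B /nbhs_md[e e0 eB].
by have [k xk] := xu e e0; exists (u k); split; [exact: Eu | exact: eB].
Qed.

End Topology.

(** * Connectedness of compact plane sets through uniform separation *)

Section UniformSeparation.
Context {R : realType}.
Local Notation C := (Cplx R).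
Implicit Types (E A : set C) (z w a : C).

(** The distances from [z] to the two square roots of [w] have product [md (w - z ^+ 2)]; take the
    nearer root. This is a quantitative form of the openness of squaring. *)
Lemma sqr_root_near z w :
  exists y, y ^+ 2 = w /\ md (y - z) ^+ 2 <= md (w - z ^+ 2).
Proof.
have hw : sqrtC w ^+ 2 = w by rewrite sqrtCK.
have e : md (w - z ^+ 2) = md (sqrtC w - z) * md (sqrtC w + z).
  by rewrite -mdM -subr_sqr hw.
have [le|le] := lerP (md (sqrtC w - z)) (md (sqrtC w + z)).
  by exists (sqrtC w); split => //; rewrite e expr2 ler_wpM2l ?md_ge0.
exists (- sqrtC w); rewrite sqrrN; split => //.
by rewrite -opprD mdN e expr2 ler_wpM2r ?md_ge0 // ltW.
Qed.

(** Disconnectedness with a gap [d] between the two pieces. For compact sets it is equivalent to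
    being disconnected, and the gap is easy to follow through quadratic maps. *)
Definition unif_sep E := exists d A, [/\ 0 < d :> R,
  forall z w, E z -> E w -> md (z - w) < d -> A z -> A w,
  exists2 z, E z & A z & exists2 z, E z & ~ A z].

Lemma connected_not_unif_sep E : connected E -> ~ unif_sep E.
Proof.
move=> cE [d [A [d0 dA [z Ez Az] [w Ew nAw]]]].
suff : E `&` A = E by move=> EA; apply: nAw; have [] : (E `&` A) w by rewrite EA.
apply: cE; first by exists z.
- exists [set y | exists2 x, (E `&` A) x & md (x - y) < d].
    rewrite openE => y [x Ax xy]; apply/nbhs_md.
    exists (d - md (x - y)); first by rewrite subr_gt0.
    move=> t yt; exists x => //; apply: le_lt_trans (_ : md (x - y) + md (y - t) < d).
      by rewrite (_ : x - t = (x - y) + (y - t)) ?md_triangle // addrA subrK.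
    by rewrite -ltrBrDl.
  apply/seteqP; split=> [y [Ey Ay]|y [Ey [x [Ex Ax] xy]]]; last first.
    by split=> //; exact: dA xy Ax.
  by split=> //; exists y => //; rewrite subrr md0.
- exists (~` [set y | exists2 x, (E `\` A) x & md (x - y) < d]).
    apply: open_closedC; rewrite openE => y [x Ax xy]; apply/nbhs_md.
    exists (d - md (x - y)); first by rewrite subr_gt0.
    move=> t yt; exists x => //; apply: le_lt_trans (_ : md (x - y) + md (y - t) < d).
      by rewrite (_ : x - t = (x - y) + (y - t)) ?md_triangle // addrA subrK.
    by rewrite -ltrBrDl.
  apply/seteqP; split=> [y [Ey Ay]|y [Ey h]]; split=> //.
    by move=> [x [Ex nAx] xy]; apply: nAx; apply: dA Ay => //; rewrite mdB.
  apply: contrapT => nAy; apply: h; exists y => //.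
  by rewrite subrr md0.
Qed.

(** Without a positive gap, a relatively clopen [B] has points arbitrarily close to points of [E]
    off [B]. By compactness such pairs cluster at a point of [B], against the relative openness of
    [B]. *)
Lemma not_unif_sep_connected E r : closed E -> (forall z, E z -> md z <= r) ->
  ~ unif_sep E -> connected E.
Proof.
move=> cE Er nsep B [b Bb] [U oU BU] [F cF BF].
have BE : B `<=` E by rewrite BU; move=> ? [].
apply/seteqP; split=> // t Et; apply: contrapT => nBt; apply: nsep.
apply: contrapT => nsep.
have /choice[u hu] : forall k, exists p : C * C,
    [/\ B p.1, E p.2, ~ B p.2 & md (p.1 - p.2) < k.+1%:R^-1].
  move=> k; apply: contrapT => h; apply: nsep; exists k.+1%:R^-1, B; split.
  - by rewrite invr_gt0.
  - move=> z w Ez Ew zw Bz; apply: contrapT => nBw; apply: h.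
    by exists (z, w).
  - by exists b => //; exact: BE.
  - by exists t.
have [|x hx] := @bounded_seq_cluster _ (fun k => (u k).1) r.
  by move=> k; apply/Er/BE; have [] := hu k.
have Bx : B x.
  rewrite BF; split; apply: (@closed_seq_cluster _ _ (fun k => (u k).1)) => //.
  - by move=> k; apply: BE; have [] := hu k.
  - by move=> e e0; have [k _] := hx e 0%N e0; exists k.
  - by move=> k; have [+ _ _ _] := hu k; rewrite BF => -[].
  - by move=> e e0; have [k _] := hx e 0%N e0; exists k.
have : nbhs x U by apply: open_nbhs_nbhs; split => //; move: Bx; rewrite BU => -[].
move=> /nbhs_md[e e0 eU].
have e20 : 0 < e / 2 by rewrite divr_gt0.
have [N _ hN] := near_infty_natSinv_lt (PosNum e20).
have [k /hN/= ke xk] := hx _ N e20.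
have [_ E2 nB2 lt2] := hu k; apply: nB2; rewrite BU; split => //; apply: eU.
rewrite (_ : x - (u k).2 = (x - (u k).1) + ((u k).1 - (u k).2)); last first.
  by rewrite addrA subrK.
rewrite (le_lt_trans (md_triangle _ _))// [ltRHS]splitr ltrD//.
exact: lt_trans ke.
Qed.

(* [z |-> z ^+ 2 + a] is open, so the image of a uniformly separated part of the
   preimage that avoids the critical point 0 is uniformly separated, and it
   misses [a]. *)
Lemma not_unif_sep_preimage E a : E a -> ~ unif_sep E ->
  ~ unif_sep [set z | E (z ^+ 2 + a)].
Proof.
move=> Ea nsep [d [A [d0 dA [z Ez Az] [w Ew nAw]]]]; apply: nsep.
suff [B [dB [x Ex Bx] nB0]] : exists B : set C, [/\ (forall z w, E (z ^+ 2 + a) ->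
    E (w ^+ 2 + a) -> md (z - w) < d -> B z -> B w),
    exists2 z, E (z ^+ 2 + a) & B z & ~ B 0].
  exists (d ^+ 2), [set y | exists2 x, B x & y = x ^+ 2 + a]; split.
  - by rewrite exprn_gt0.
  - move=> x' y + Ey + [t Bt x't]; rewrite {}x't => Et ty.
    have [s [sy ts]] := sqr_root_near t (y - a).
    have ys : y = s ^+ 2 + a by rewrite sy subrK.
    exists s => //; apply: (dB t) => //; first by rewrite -ys.
    rewrite mdB -(@ltr_pXn2r R 2) ?nnegrE ?md_ge0 ?(ltW d0) //.
    apply: le_lt_trans ts _; rewrite mdB; apply: le_lt_trans ty.
    by rewrite opprB addrA addrAC.
  - by exists (x ^+ 2 + a) => //; exists x.
  - exists a => // -[t Bt]; move/esym/eqP; rewrite -subr_eq0 addrK expf_eq0 /=.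
    by move=> /eqP t0; rewrite t0 in Bt.
have E0 : E (0 ^+ 2 + a) by rewrite expr0n add0r.
(* One of [A] and its complement avoids 0, and both satisfy the separation hypotheses. *)
have [A0|A0] := pselect (A 0); last by exists A; split => //; exists z.
exists (~` A); split => [s t Es Et st ns At| |]; last by [].
  by apply: ns; apply: (dA t) => //; rewrite mdB.
by exists w.
Qed.

Lemma unif_sep_preimage E a r : (forall z, E (z ^+ 2 + a) -> md z <= r) ->
  unif_sep E -> unif_sep [set z | E (z ^+ 2 + a)].
Proof.
move=> Er [d [A [d0 dA [z Ez Az] [w Ew nAw]]]].
have root y : exists x : C, x ^+ 2 + a = y.
  by exists (sqrtC (y - a)); rewrite sqrtCK subrK.
have [x xz] := root z; have [y yw] := root w.
have r0 : 0 <= r by apply: le_trans (md_ge0 x) (Er x _); rewrite xz.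
(* [z ^+ 2 + a] is Lipschitz with constant [r + r] on the preimage; the added 1 keeps the
   denominator positive when [r = 0]. *)
exists (d / (r + r + 1)), [set x | A (x ^+ 2 + a)]; split.
- by rewrite divr_gt0 //; lra.
- move=> s t Es Et st; apply: dA => //.
  rewrite (_ : _ - _ = (s - t) * (s + t)); last by ring.
  rewrite mdM; have st2 := md_triangle s t.
  have := Er _ Es; have := Er _ Et => h1 h2.
  rewrite ltr_pdivlMr in st; last lra.
  apply: le_lt_trans st; apply: ler_wpM2l; first exact: md_ge0.
  lra.
- by exists x; rewrite /= xz.
- by exists y; rewrite /= yw.
Qed.

(** The segment from [z] to [w] stays in the disc, and [N] steps shorter than [d] carry [A] from one
    end to the other. *)
Lemma disc_not_unif_sep r : ~ unif_sep [set z | md z <= r].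
Proof.
move=> [d [A [d0 dA [z Ez Az] [w Ew nAw]]]].
have [N hN] : exists N : nat, md (w - z) / d < N%:R.
  exists (Num.bound (md (w - z) / d)).
  by apply/archi_boundP/divr_ge0; [exact: md_ge0 | exact: ltW].
have N0 : 0 < N%:R :> R by apply: le_lt_trans hN; rewrite divr_ge0 ?md_ge0 ?ltW.
pose t (k : nat) : R := k%:R / N%:R.
pose x k : C := z + (t k)%:C * (w - z).
have tN : t N = 1 by rewrite /t divff // gt_eqF.
have Ex k : (k <= N)%N -> md (x k) <= r.
  move=> kN; have t0 : 0 <= t k by rewrite divr_ge0 ?ler0n.
  have t1 : t k <= 1 by rewrite ler_pdivrMr // mul1r ler_nat.
  have -> : x k = (1 - t k)%:C * z + (t k)%:C * w.
    by rewrite /x rmorphB rmorph1; ring.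
  apply: le_trans (md_triangle _ _) _; rewrite !mdM !md_real !ger0_norm ?subr_ge0 //.
  by rewrite /= in Ez Ew; nra.
have Ax k : (k <= N)%N -> A (x k).
  elim: k => [_|k IH kN]; first by rewrite /x /t mul0r mul0r addr0.
  apply: (dA (x k)); [exact/Ex/ltnW|exact: Ex| |exact/IH/ltnW].
  have -> : x k - x k.+1 = (t k - t k.+1)%:C * (w - z).
    by rewrite /x rmorphB; ring.
  rewrite mdM md_real /t -mulrBl -natr1 opprD addNKr.
  rewrite normrM normrN1 mul1r gtr0_norm ?invr_gt0 // mulrC ltr_pdivrMr //.
  by rewrite mulrC -ltr_pdivrMr.
by apply: nAw; have := Ax N (leqnn N); rewrite /x tN rmorph1 mul1r addrC subrK.
Qed.

Lemma nested_not_unif_sep (D : nat -> set C) r : (forall k, closed (D k)) ->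
  (forall k, D k.+1 `<=` D k) -> (forall z, D 0%N z -> md z <= r) ->
  (forall k, ~ unif_sep (D k)) -> ~ unif_sep (\bigcap_k D k).
Proof.
move=> cD DS Dr nsep [d [A [d0 dA [z Ez Az] [w Ew nAw]]]].
have Dle k m : (k <= m)%N -> D m `<=` D k.
  move=> /subnK <-; elim: (m - k)%N => // i IH x /DS; exact: IH.
have d30 : 0 < d / 3 by rewrite divr_gt0.
(* By compactness some [D k] lies in the [d / 3]-neighbourhood of the intersection; thickening [A]
   by [d / 3] then separates this [D k]. *)
have [k hk] : exists k, forall x, D k x ->
    exists2 y, (\bigcap_k D k) y & md (y - x) < d / 3.
  apply: contrapT => h.
  have /choice[u hu] : forall k, exists x, D k x /\
     forall y, (\bigcap_k D k) y -> ~ md (y - x) < d / 3.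
    move=> k; apply: contrapT => h'; apply: h; exists k => x Dx.
    apply: contrapT => h''; apply: h'; exists x; split => // y Dy yx.
    by apply: h''; exists y.
  have [|x hx] := @bounded_seq_cluster _ u r.
    by move=> k; apply/Dr/(Dle 0%N k)=> //; have [] := hu k.
  have Dx : (\bigcap_k D k) x.
    move=> k _; apply: (@closed_seq_cluster _ _ (fun i => u (maxn k i))) => //.
      by move=> i; apply: (Dle k _ (leq_maxl k i)); have [] := hu (maxn k i).
    move=> e e0; have [i ki xi] := hx e k e0; exists i.
    by rewrite (maxn_idPr ki).
  by have [k _ xk] := hx _ 0%N d30; have [_ /(_ _ Dx)] := hu k.
have tri (s t s' t' : C) : md (s' - s) < d / 3 -> md (t' - t) < d / 3 ->
    md (s - t) < d / 3 -> md (s' - t') < d.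
  move=> h1 h2 h3; rewrite mdB in h2.
  rewrite (_ : s' - t' = (s' - s) + (s - t) + (t - t')); last by ring.
  have := md_triangle (s' - s + (s - t)) (t - t').
  have := md_triangle (s' - s) (s - t); lra.
apply: (nsep k); exists (d / 3), [set x | exists y, [/\ (\bigcap_k D k) y, A y &
  md (y - x) < d / 3]]; split => //.
- move=> s t Ds Dt st [s' [Ds' As' ss']].
  have [t' Dt' tt'] := hk _ Dt; exists t'; split => //.
  by apply: dA As' => //; exact: (tri s t).
- exists z; first exact: Ez.
  by exists z; rewrite subrr md0.
- exists w; first exact: Ew.
  move=> [y [Dy Ay yw]]; apply: nAw; apply: dA Ay => //; lra.
Qed.

End UniformSeparation.

(** * Splitting of the preimage of a set under [z ^+ 2 + b] *)

Section Splitting.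
Context {R : realType}.
Local Notation C := (Cplx R).
Implicit Types (K A : set C) (z w b : C) (r e : R).

Lemma md_distD z w t : md (z - t) <= md (z - w) + md (w - t).
Proof. by rewrite (_ : z - t = (z - w) + (w - t)) ?md_triangle // addrA subrK. Qed.

Lemma md_le_sub z w : md z - md w <= md (z - w).
Proof. exact: le_trans (ler_norm _) (md_sub_abs z w). Qed.

Lemma md_double z : md (z + z) = 2 * md z.
Proof.
have -> : z + z = (2 : R)%:C * z by rewrite (natrD _ 1 1) rmorphD mulrDl mul1r.
by rewrite mdM md_real ger0_norm.
Qed.

(* Stands for the existence of a continuous branch of the square root of
   [w - b] on [K]: [A] is the set of its values at the points [z ^+ 2 + b]. *)
Definition splits K b := exists d A, [/\ 0 < d :> R,
  forall z, K (z ^+ 2 + b) -> (A (- z) <-> ~ A z) &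
  forall z w, K (z ^+ 2 + b) -> K (w ^+ 2 + b) -> md (z - w) < d -> A z -> A w].

Lemma splits_unif_sep K b : splits K b -> [set z | K (z ^+ 2 + b)] !=set0 ->
  unif_sep [set z | K (z ^+ 2 + b)].
Proof.
move=> [d [A [d0 sA dA]]] [z Kz].
have Kz' : K ((- z) ^+ 2 + b) by rewrite sqrrN.
exists d, A; split => //; have [Az|nAz] := pselect (A z).
- by exists z.
- by exists (- z) => //; apply/sA.
- by exists (- z) => // /(sA _ Kz).
- by exists z.
Qed.

(** With [c ^+ 2 = - b], preimages satisfy [md (z - c) * md (z + c) <= r < md c ^+ 2 / 4], so each
    lies within [md c / 2] of exactly one of [c] and [- c]. *)
Lemma splits_far K r b : (forall w, K w -> md w <= r) -> 4 * r < md b ->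
  splits K b.
Proof.
move=> Kr rb; pose c : C := sqrtC (- b).
have cb : c ^+ 2 = - b by rewrite sqrtCK.
have mc : md c ^+ 2 = md b by rewrite -mdX cb mdN.
have c0 := md_ge0 c.
have prod z : K (z ^+ 2 + b) -> md (z - c) * md (z + c) <= r.
  by move=> /Kr; rewrite -mdM -subr_sqr cb opprK.
have sum z w : 2 * md c <= md (z - c) + md (w + c) + md (z - w).
  rewrite -md_double (_ : c + c = - (z - c) + (w + c) + (z - w)); last by ring.
  have := md_triangle (- (z - c) + (w + c)) (z - w).
  have := md_triangle (- (z - c)) (w + c); rewrite mdN; lra.
(* If [c = 0] then [r < 0], so the preimage is empty. *)
have [cz|cpos] := eqVneq (md c) 0.
  exists 1, set0; split => // z /prod h; exfalso.
  have := md_ge0 (z - c); have := md_ge0 (z + c).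
  by rewrite -mc cz in rb; nra.
have {}cpos : 0 < md c by rewrite lt_neqAle eq_sym cpos.
exists (md c), [set z | md (z - c) <= md c / 2]; split => // [z Kz|z w Kz Kw zw /= Az].
  rewrite /= (_ : - z - c = - (z + c)) ?mdN; last by rewrite opprD.
  have := sum z z; rewrite subrr md0 => s.
  split; first by move=> h /= h'; lra.
  move=> /negP; rewrite -ltNge => h.
  rewrite leNgt; apply/negP => h'.
  by have := prod z Kz; nra.
rewrite leNgt; apply/negP => h.
have h' : md (w + c) <= md c / 2.
  by rewrite leNgt; apply/negP => h'; have := prod w Kw; nra.
have := sum z w; lra.
Qed.

(* For [b] and [b'] close to [b0], off [K], each root of [z ^+ 2 + b' = x] with
   [x] in [K] is close to exactly one root of [z ^+ 2 + b = x]. *)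
Lemma splits_locally_constant K b0 e : 0 < e ->
  (forall w, K w -> e ^+ 2 <= md (b0 - w)) ->
  exists2 r, 0 < r & forall b b', md (b0 - b) < r -> md (b0 - b') < r ->
    splits K b -> splits K b'.
Proof.
move=> e0 Ke; have e20 : 0 < e ^+ 2 by rewrite exprn_gt0.
(* Two parameters in this disc differ by less than [(e / 8) ^+ 2], so roots can be matched within
   [e / 8], while all roots have modulus at least [e / 2]. *)
exists (e ^+ 2 / 128); first lra.
move=> b b' bb bb' [d [A [d0 sA dA]]].
have low (x y : C) : md (b0 - x) < e ^+ 2 / 128 -> K (y ^+ 2 + x) -> e / 2 <= md y.
  move=> x0 /Ke h; rewrite -(@ler_pXn2r R 2) ?nnegrE ?md_ge0 //; last lra.
  rewrite -mdX; have := md_triangle (b0 - x) (- y ^+ 2).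
  rewrite mdN (_ : b0 - x + - y ^+ 2 = b0 - (y ^+ 2 + x)); last by ring.
  by rewrite expr_div_n; lra.
pose near z y := y ^+ 2 + b = z ^+ 2 + b' /\ md (y - z) <= e / 8.
have near_ex z : exists y, near z y.
  have [y [yz le]] := sqr_root_near z (z ^+ 2 + b' - b).
  exists y; split; first by rewrite yz subrK.
  rewrite -(@ler_pXn2r R 2) ?nnegrE ?md_ge0 //; last lra.
  apply: (le_trans le); have -> : z ^+ 2 + b' - b - z ^+ 2 = (b' - b0) + (b0 - b).
    by ring.
  have := md_triangle (b' - b0) (b0 - b); rewrite (mdB b' b0) expr_div_n; lra.
have near_uniq z y y' : K (z ^+ 2 + b') -> near z y -> near z y' -> y = y'.
  move=> Kz [y1 y2] [y1' y2']; have lz := low _ _ bb' Kz.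
  have /eqP : y ^+ 2 = y' ^+ 2 by apply: (addIr b); rewrite y1 y1'.
  rewrite eqf_sqr => /orP[/eqP//|/eqP yy].
  have : md (z + z) <= md (y - z) + md (y' - z).
    rewrite (_ : z + z = - (y - z) - (y' - z)); last by rewrite yy; ring.
    by apply: le_trans (md_triangle _ _) _; rewrite !mdN.
  by rewrite md_double => ?; exfalso; lra.
have nearN z y : near z y -> near (- z) (- y).
  by move=> [h1 h2]; split; rewrite ?sqrrN // -opprD mdN.
exists (Num.min (d / 2) (e / 8)), [set z | exists2 y, near z y & A y]; split.
- by rewrite lt_min; apply/andP; split; lra.
- move=> z Kz; have [y yz] := near_ex z.
  have Ky : K (y ^+ 2 + b) by rewrite (proj1 yz).
  have Kz' : K ((- z) ^+ 2 + b') by rewrite sqrrN.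
  split.
    move=> [y' y'z Ay'] [y'' y''z Ay''].
    have y'y := near_uniq _ _ _ Kz' y'z (nearN _ _ yz).
    have y''y := near_uniq _ _ _ Kz y''z yz.
    by rewrite y'y y''y in Ay' Ay''; move: Ay' => /(sA y Ky).
  move=> h; exists (- y); first exact: nearN.
  by apply/(sA y Ky) => Ay; apply: h; exists y.
- move=> z w Kz Kw zw [y yz Ay]; have [x xw] := near_ex w; exists x => //.
  have Ky : K (y ^+ 2 + b) by rewrite (proj1 yz).
  have Kx : K (x ^+ 2 + b) by rewrite (proj1 xw).
  apply: dA Ay => //.
  move: zw; rewrite lt_min => /andP[zw1 zw2].
  have [[y1 y2] [x1 x2]] := (yz, xw).
  have ly := low _ _ bb Ky.
  (* Both sides come from [y ^+ 2 - x ^+ 2 = z ^+ 2 - w ^+ 2]. Comparing the sums [y + x] and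
     [z + w] gives [md (y - x) <= 2 * md (z - w) < d]. *)
  have eq : md (y - x) * md (y + x) = md (z - w) * md (z + w).
    by rewrite -!mdM -!subr_sqr; congr md; apply: (addIr (x ^+ 2 + b));
       rewrite addrA subrK y1 x1; ring.
  have yx : md (y - x) <= 3 * e / 8.
    have := md_distD y z x; have := md_distD z w x; rewrite (mdB w x); lra.
  have yx' : 5 * e / 8 <= md (y + x).
    have := md_distD (y + y) (y + x) 0; rewrite !subr0.
    rewrite (_ : y + y - (y + x) = y - x); last by ring.
    rewrite md_double; lra.
  have zw3 : md (z + w) <= 2 * md (y + x).
    have := md_triangle (y + x) (- (y - z) - (x - w)).
    have := md_triangle (- (y - z)) (- (x - w)); rewrite !mdN.
    rewrite (_ : y + x + (- (y - z) - (x - w)) = z + w); last by ring.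
    lra.
  have := md_ge0 (z - w); have := md_ge0 (y - x) => h1 h2.
  have h3 : md (z - w) * md (z + w) <= md (z - w) * (2 * md (y + x)) by rewrite ler_wpM2l.
  have h4 : md (y - x) <= 2 * md (z - w).
    rewrite -(@ler_pM2r _ (md (y + x))); last lra.
    by rewrite eq; lra.
  lra.
Qed.

End Splitting.

(** * Orbits under a sequence of quadratic maps *)

Section Orbits.
Context {R : realType}.
Local Notation C := (Cplx R).
Implicit Types (a : nat -> C) (z w : C) (r M : R) (k : nat).

Fixpoint orb a k z : C := if k is k'.+1 then orb a k' z ^+ 2 + a k' else z.

Definition shift1 a : nat -> C := fun k => a k.+1.

Lemma orbSr a k z : orb a k.+1 z = orb (shift1 a) k (z ^+ 2 + a 0%N).
Proof. by elim: k => //= k <-. Qed.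

(** If [1 <= r], [M + r <= r ^+ 2] and all [md (a k) <= M], this is the set of points with bounded
    orbit. *)
Definition julia a r : set C := [set z | forall k, md (orb a k z) <= r].

Lemma orb_continuous (T : topologicalType) (a : T -> nat -> C) (z : T -> C) k :
  (forall i, continuous (a^~ i)) -> continuous z ->
  continuous (fun t => orb (a t) k (z t)).
Proof.
move=> ca cz; elim: k => [//|k IH] t /=.
apply: (@cvgD _ C); last exact: ca.
by apply: (@cvgM C); exact: IH.
Qed.

Lemma orb_continuousr a k : continuous (orb a k).
Proof.
apply: (@orb_continuous C (fun _ => a) id) => [i|z]; last exact: cvg_id.
exact: cst_continuous.
Qed.

Lemma julia_closed a r : closed (julia a r).
Proof.
have -> : julia a r = \bigcap_k [set z | md (orb a k z) <= r].
  by apply/seteqP; split=> [z h k _|z h k]; exact: h.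
by apply: closed_bigI => k _; apply/closed_md_le/orb_continuousr.
Qed.

(** The condition [M + r <= r ^+ 2] makes [r] an escape radius: the preimage of the disc of radius
    [r] lies in that disc. *)
Lemma sqr_add_le r M z b : 0 <= r -> M + r <= r ^+ 2 -> md b <= M ->
  md (z ^+ 2 + b) <= r -> md z <= r.
Proof.
move=> r0 Mr bM h; rewrite -(@ler_pXn2r R 2) ?nnegrE ?md_ge0 // -mdX.
have := md_triangle (z ^+ 2 + b) (- b); rewrite addrK mdN; lra.
Qed.

Lemma julia_preimage a r M : 0 <= r -> M + r <= r ^+ 2 -> md (a 0%N) <= M ->
  julia a r = [set z | julia (shift1 a) r (z ^+ 2 + a 0%N)].
Proof.
move=> r0 Mr aM; apply/seteqP; split=> z h k; first by rewrite -orbSr.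
case: k => [|k]; last by rewrite orbSr.
by apply: (sqr_add_le _ _ _ _ r0 Mr aM); exact: (h 0%N).
Qed.

Lemma orb_open a k z e : 0 < e -> exists2 d : R, 0 < d &
  forall w, md (w - orb a k z) < d -> exists2 y, md (y - z) < e & orb a k y = w.
Proof.
move=> e0; elim: k => [|k [d d0 IH]] /=; first by exists e => // w; exists w.
exists (d ^+ 2); first by rewrite exprn_gt0.
move=> w wd; have [x [xw xz]] := sqr_root_near (orb a k z) (w - a k).
have [|y yz yx] := IH x.
  rewrite -(@ltr_pXn2r R 2) ?nnegrE ?md_ge0 ?(ltW d0) //.
  by apply: le_lt_trans xz _; rewrite -addrA -opprD (addrC (a k)).
by exists y => //; rewrite yx xw subrK.
Qed.

(* The set [U] of points off [julia a r] at which the splitting fails would be a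
   bounded open set with boundary in [julia a r]; the maximum principle for the
   open map [orb a k] then gives [U `<=` julia a r]. *)
Lemma splits_off_julia a r b : 0 <= r -> ~ julia a r b -> splits (julia a r) b.
Proof.
move=> r0 nKb; set K := julia a r in nKb *; apply: contrapT => nsb.
have Kr w : K w -> md w <= r by move=> /(_ 0%N).
pose U := [set x | ~ K x /\ ~ splits K x].
have Ub : U b by [].
have [k bk] : exists k, r < md (orb a k b).
  apply: contrapT => h; apply: nKb => k; rewrite leNgt; apply/negP => h'.
  by apply: h; exists k.
have cf : continuous (fun z => md (orb a k z)).
  move=> x; apply: continuous_comp; last exact: md_continuous.
  exact: orb_continuousr.
have Ule : U `<=` [set z | md z <= 4 * r].
  by move=> x [_ nx] /=; rewrite leNgt; apply/negP => h; apply: nx; exact: splits_far Kr h.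
have cU : compact (closure U).
  apply: (@bounded_closed_compact_md _ _ (4 * r)); first exact: closed_closure.
  move=> z Uz.
  have Dz : closure [set x : C | md x <= 4 * r] z := closure_subset Ule Uz.
  exact (@disc_closed R (4 * r) z Dz).
(* Maximum of an iterate over the closure of [U], with [k] chosen so that the orbit of [b] has left
   the disc at time [k]; hence [c] is off [K]. *)
have [c /set_mem Uc cmax] := compact_EVT_max (ex_intro _ b (subset_closure Ub)) cU
  (continuous_subspaceT cf).

have ck : r < md (orb a k c).
  by apply: lt_le_trans bk (cmax _ _); exact/mem_set/subset_closure.
have nKc : ~ K c by move=> /(_ k); rewrite leNgt ck.
have [e e0 ce] : exists2 e : R, 0 < e & forall w, md (c - w) < e -> ~ K w.
  apply/nbhs_md/open_nbhs_nbhs; split => //; apply: closed_openC.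
  exact: julia_closed.
pose s := Num.min e 1.
have s0 : 0 < s by rewrite lt_min e0 ltr01.
have [d d0 hd] : exists2 d, 0 < d & forall b b', md (c - b) < d ->
    md (c - b') < d -> splits K b -> splits K b'.
  apply: (@splits_locally_constant _ _ _ s s0) => w Kw.
  rewrite leNgt; apply/negP => h; apply: (ce w) Kw.
  apply: lt_le_trans h _; have : s <= e by rewrite ge_min lexx.
  have : s <= 1 by rewrite ge_min lexx orbT.
  nra.
have me : 0 < Num.min d e by rewrite lt_min d0.
have [u [[nKu nsu] cu]] : U `&` [set y | md (c - y) < Num.min d e] !=set0.
  by apply: Uc; apply/nbhs_md; exists (Num.min d e).
have {cu} cu : md (c - u) < d by move: cu; rewrite /= lt_min => /andP[].
(* Splitting is locally constant near [c] and fails at [u], so [c] is interior to [U]. *)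
have cUsub x : md (x - c) < Num.min d e -> U x.
  rewrite mdB lt_min => /andP[xd xe]; split; first exact: ce.
  by move=> sx; apply/nsu/(hd x u).
have [t t0 ht] := orb_open a k c _ me.
set q := orb a k c in ck ht.
(* Moving from [q] to [(1 + l) * q] covers the distance [t / 2 < t], so this point of larger modulus
   is a value of the iterate on [U], against maximality. *)
pose l := t / (2 * md q).
have q0 : 0 < md q by exact: le_lt_trans ck.
have l0 : 0 < l by rewrite divr_gt0 //; lra.
have [|x xc xq] := ht ((1 + l)%:C * q).
  rewrite rmorphD rmorph1 mulrDl mul1r addrAC subrr add0r mdM md_real gtr0_norm //.
  by rewrite /l invfM mulrA mulfVK ?gt_eqF //; lra.
have := cmax x (mem_set (subset_closure (cUsub x xc))).
rewrite xq mdM md_real gtr0_norm; last lra.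
rewrite -/q; nra.
Qed.

Lemma critical_value_julia a r M : 0 <= r -> M + r <= r ^+ 2 ->
  md (a 0%N) <= M -> julia a r !=set0 -> ~ unif_sep (julia a r) ->
  julia (shift1 a) r (a 0%N).
Proof.
move=> r0 Mr aM; rewrite (julia_preimage _ _ _ r0 Mr aM) => ne nsep.
by apply: contrapT => na; apply/nsep/splits_unif_sep => //; exact: splits_off_julia.
Qed.

Lemma julia_shift_not_unif_sep a r M : 0 <= r -> M + r <= r ^+ 2 ->
  md (a 0%N) <= M -> ~ unif_sep (julia a r) -> ~ unif_sep (julia (shift1 a) r).
Proof.
move=> r0 Mr aM; rewrite (julia_preimage _ _ _ r0 Mr aM) => nsep sep; apply: nsep.
apply: (unif_sep_preimage _ _ r) => // z h; apply: (sqr_add_le _ _ _ _ r0 Mr aM).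
exact: (h 0%N).
Qed.

Lemma julia_not_unif_sep a :
  (forall j k, md (orb (fun i => a (j + i)%N) k 0) <= 2) -> ~ unif_sep (julia a 2).
Proof.
move=> h; have a2 j : md (a j) <= 2.
  by have := h j 1%N; rewrite /= expr0n add0r addn0.
pose D k : set C := [set z | md (orb a k z) <= 2].
have -> : julia a 2 = \bigcap_k D k.
  by apply/seteqP; split=> [z hz k _|z hz k]; exact: hz.
apply: (@nested_not_unif_sep _ _ 2) => //.
- by move=> k; apply/closed_md_le/orb_continuousr.
- by move=> k z; apply: (sqr_add_le _ 2 _ _ _ _ (a2 k)); rewrite ?expr2; lra.
(* The induction ranges over all sequences: a preimage of the disc under [k.+1] maps is pulled back
   by the first map from one for the shifted sequence. *)
rewrite /D => k; elim: k a h {a2 D} => [|k IH] a h; first exact: disc_not_unif_sep.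
have -> : [set z | md (orb a k.+1 z) <= 2] =
    [set z | [set w | md (orb (shift1 a) k w) <= 2] (z ^+ 2 + a 0%N)].
  by apply/seteqP; split=> z; rewrite /= -/(orb a k.+1 z) orbSr.
apply: not_unif_sep_preimage; last by apply: IH => j; exact: (h j.+1).
by have := h 0%N k.+1; rewrite orbSr /= expr0n add0r.
Qed.

End Orbits.

(** * Periodic sequences and the connectedness criterion *)

Section Periodic.
Context {R : realType}.
Local Notation C := (Cplx R).
Implicit Types (a : nat -> C) (s : seq C) (z : C) (r M : R).

Definition shiftn j a : nat -> C := fun i => a (j + i)%N.

Definition per s : nat -> C := fun i => s`_(i %% size s).

Lemma orbD a m k z : orb a (m + k) z = orb (shiftn m a) k (orb a m z).
Proof. by elim: k => [|k IH]; rewrite ?addn0 // addnS /= IH. Qed.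

Lemma eq_orb a b k z : (forall i, (i < k)%N -> a i = b i) -> orb a k z = orb b k z.
Proof.
elim: k => //= k IH ab; rewrite ab // IH // => i ik.
by apply: ab; exact: ltnW.
Qed.

Lemma quad_comp_rcons s c : quad_comp (rcons s c) = quad_comp s ^+ 2 + c%:P.
Proof.
by rewrite /quad_comp foldl_rcons rmorphD /= comp_polyC rmorphXn /= comp_polyX.
Qed.

Lemma horner_quad_comp s z : (quad_comp s).[z] = orb (per s) (size s) z.
Proof.
transitivity (orb (nth 0 s) (size s) z); last first.
  by apply: eq_orb => i /modn_small; rewrite /per => ->.
elim/last_ind: s => [|s c IH]; first by rewrite hornerX.
rewrite quad_comp_rcons hornerD hornerC horner_exp size_rcons /= IH.
rewrite nth_rcons ltnn eqxx; congr (_ ^+ 2 + _).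
by apply: eq_orb => i si; rewrite nth_rcons si.
Qed.

Lemma size_quad_comp s : size (quad_comp s) = (2 ^ size s).+1.
Proof.
elim/last_ind: s => [|s c IH]; first by rewrite size_polyX.
have qs : quad_comp s ^+ 2 = 'X^2 \Po quad_comp s by rewrite rmorphXn /= comp_polyX.
have s2 : size (quad_comp s ^+ 2) = (2 ^ (size s).+1).+1.
  have := size_comp_poly ('X^2 : {poly C}) (quad_comp s).
  rewrite -qs size_polyXn IH /= expnS => <-; rewrite prednK // size_poly_gt0.
  by rewrite expf_neq0 // -size_poly_gt0 IH.
rewrite size_rcons quad_comp_rcons size_polyDl s2 //.
by rewrite (leq_ltn_trans (size_polyC_leq1 c)) // ltnS expn_gt0.
Qed.

Lemma perD s k i : per s (k * size s + i)%N = per s i.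
Proof. by rewrite /per modnMDl. Qed.

Lemma iter_quad_comp s k z :
  iter k (horner (quad_comp s)) z = orb (per s) (k * size s) z.
Proof.
elim: k => //= k ->; rewrite horner_quad_comp mulSnr orbD.
by apply: eq_orb => i _; rewrite /shiftn perD.
Qed.

(* Once above [r], the distance of the orbit to the disc of radius [r] at least
   doubles at each step. *)
Lemma julia_bounded a r M B n z : 1 <= r -> M + r <= r ^+ 2 ->
  (forall k, md (a k) <= M) -> (0 < n)%N ->
  (forall k, md (orb a (k * n) z) <= B) -> julia a r z.
Proof.
move=> r1 Mr aM n0 zB k; rewrite leNgt; apply/negP => rk.
pose x := md (orb a k z) - r; have x0 : 0 < x by rewrite subr_gt0.
have grow m : r + m.+1%:R * x <= md (orb a (k + m) z).
  elim: m => [|m IH]; first by rewrite addn0 mul1r /x addrC subrK.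
  rewrite addnS /=; have := md_le_sub (orb a (k + m) z ^+ 2) (- a (k + m)%N).
  rewrite opprK mdN mdX; have := aM (k + m)%N.
  have mx : x <= m.+1%:R * x by rewrite ler_peMl ?ler1n // ltW.
  rewrite -(natr1 m.+1) mulrDl mul1r; move: IH mx.
  move: (m.+1%:R * x) (md (orb a (k + m) z)) => y u; nra.
have B0 : 0 <= B by apply: le_trans (zB 0%N); exact: md_ge0.
have hm : B / x < (Num.bound (B / x))%:R by apply/archi_boundP/divr_ge0 => //; exact: ltW.
set m := Num.bound _ in hm.
(* The bound [B] is known only at multiples of [n]; at time [(k + m) * n] the orbit has already
   outgrown it, since [m%:R * x] exceeds [B]. *)
have kn : (k + m <= (k + m) * n)%N by rewrite leq_pmulr.
have := grow ((k + m) * n - k)%N; rewrite subnKC; last exact: leq_trans (leq_addr m k) kn.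
apply/negP; rewrite -ltNge; apply: le_lt_trans (zB _) _.
rewrite ltr_pdivrMr // in hm; apply: (lt_le_trans hm).
have : m%:R * x <= ((k + m) * n - k).+1%:R * x.
  by rewrite ler_wpM2r ?(ltW x0) // ler_nat leqW // leq_subRL // (leq_trans _ kn) // leq_addr.
lra.
Qed.

Lemma filled_juliaP (p : {poly C}) z :
  filled_julia p z <-> exists B, forall k, md (iter k (horner p) z) <= B.
Proof.
have pf : ProperFilter (globally (forward_orbit p z)).
  by apply: globally_properfilter; exists 0%N.
have := @ex_bound _ _ _ id _ pf; rewrite /filled_julia /= => ->.
split=> [[B hB]|[B hB]].
  exists (complex.Re B) => k.
  have : forward_orbit p z (iter k (horner p) z) by exists k.
  by move=> /hB; rewrite /= mdE lecE => /andP[].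
by exists B%:C => _ [k _ <-] /=; rewrite mdE lecR.
Qed.

Lemma filled_julia_quad_comp s r M : 1 <= r -> M + r <= r ^+ 2 ->
  (forall k, md (per s k) <= M) -> (0 < size s)%N ->
  filled_julia (quad_comp s) = julia (per s) r.
Proof.
move=> r1 Mr sM s0; apply/seteqP; split=> z.
  move=> /filled_juliaP[B hB]; apply: (julia_bounded _ _ _ B _ _ r1 Mr sM s0) => k.
  by rewrite -iter_quad_comp.
by move=> zr; apply/filled_juliaP; exists r => k; rewrite iter_quad_comp.
Qed.

(** A fixed point exists, because [quad_comp s - 'X] has degree at least 2. *)
Lemma filled_julia_neq0 s : (0 < size s)%N -> filled_julia (quad_comp s) !=set0.
Proof.
move=> s0; have : size (quad_comp s - 'X) != 1%N.
  have s2 : (2 ^ 1 <= 2 ^ size s)%N by rewrite leq_exp2l.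
  rewrite size_polyDl size_quad_comp; last by rewrite size_polyN size_polyX.
  by rewrite eqSS gtn_eqF // (leq_trans _ s2).
move=> /closed_rootP[z]; rewrite rootE hornerD hornerN hornerX subr_eq0 => /eqP hz.
exists z; apply/filled_juliaP; exists (md z) => k.
by rewrite iter_fix.
Qed.

Lemma per_max s : (0 < size s)%N ->
  exists j, forall i, md (per s i) <= md (per s j).
Proof.
move=> s0; have [j _ hj] := @Order.TotalTheory.arg_maxP _ _ _ (Ordinal s0) predT
  (fun i : 'I_(size s) => md s`_i) isT.
exists j => i; rewrite {2}/per modn_small //.
exact: (hj (Ordinal (ltn_pmod i s0))).
Qed.

Lemma connected_filled_juliaP s : (0 < size s)%N ->
  connected (filled_julia (quad_comp s)) <->
  forall j k, md (orb (shiftn j (per s)) k 0) <= 2.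
Proof.
move=> s0; split=> [|h]; last first.
  have a2 k : md (per s k) <= 2.
    by have := h k 1%N; rewrite /= expr0n add0r /shiftn addn0.
  rewrite (filled_julia_quad_comp _ 2 2) //; [|lra|rewrite expr2; lra].
  apply: (not_unif_sep_connected _ 2); first exact: julia_closed.
    by move=> z /(_ 0%N).
  exact: julia_not_unif_sep.
have [m hm] := per_max s s0; set M := md (per s m) in hm.
have M0 : 0 <= M by exact: md_ge0.
(* A provisional escape radius, available before the coefficients are known to be at most 2 in
   modulus. *)
pose r := M + 2.
have r1 : 1 <= r by rewrite /r; lra.
have r0 : 0 <= r by rewrite /r; lra.
have Mr : M + r <= r ^+ 2 by rewrite /r; nra.
have := filled_julia_neq0 s s0.
rewrite (filled_julia_quad_comp _ _ _ r1 Mr) // => ne /connected_not_unif_sep nsep.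
have shiftS j : shiftn j.+1 (per s) = shift1 (shiftn j (per s)).
  by apply/funext => i; rewrite /shiftn /shift1 addnS addSn.
have H j : julia (shiftn j (per s)) r !=set0 /\ ~ unif_sep (julia (shiftn j (per s)) r).
  elim: j => [//|j [[z hz] IH]]; rewrite shiftS; split; last first.
    by apply: (julia_shift_not_unif_sep _ _ M r0 Mr _ IH); exact: hm.
  exists (z ^+ 2 + shiftn j (per s) 0%N).
  by move: hz; rewrite (julia_preimage _ _ _ r0 Mr) // /shiftn.
have crit j k : md (orb (shiftn j (per s)) k 0) <= r.
  case: k => [|k]; first by rewrite /= md0.
  rewrite orbSr expr0n add0r; have [ne' nsep'] := H j.
  by apply: (critical_value_julia _ _ M r0 Mr _ ne' nsep'); exact: hm.
have M2 : M <= 2.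
  rewrite leNgt; apply/negP => M2.
  (* For [M > 2] the radius [M / 2 + 1] is still an escape radius but is smaller than [M], so the
     critical value [per s m], of modulus [M], would have to escape. *)
  have : julia (shiftn m.+1 (per s)) (M / 2 + 1) (per s m).
    apply: (julia_bounded _ _ M r 1); rewrite ?expr2 //; [lra|nra|..].
      by move=> k; exact: hm.
    move=> k; have := crit m (k * 1).+1; rewrite orbSr expr0n add0r /= -shiftS.
    by rewrite {2}/shiftn addn0.
  move=> /(_ 0%N) /=; rewrite -/M; lra.
move=> j; apply: (julia_bounded _ _ 2 r 1) => //; rewrite ?expr2; try lra.
by move=> k; apply: le_trans (hm _) M2.
Qed.

End Periodic.

(** * Continuous dependence of the coefficients on the parameters *)

Section Coefficients.
Context {R : realType}.
Local Notation C := (Cplx R).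

Lemma matrix_continuous (T U : topologicalType) m n (f : T -> 'M[U]_(m, n)) :
  (forall i j, continuous (fun x => f x i j)) -> continuous f.
Proof.
move=> cf x A [P Px PA]; apply: (@filterS _ _ _ [set y | forall i j, P i j (f y i j)]).
  by move=> y Py; exact: PA.
by do 2![apply: filter_forall => ?]; exact/cf/Px.
Qed.

Lemma coef_quad_comp_continuous (T : topologicalType) (f : T -> nat -> C) n i :
  (forall j, continuous (f^~ j)) ->
  continuous (fun t => (quad_comp (mkseq (f t) n))`_i).
Proof.
move=> cf; elim: n i => [|n IH] i t; first exact: cst_continuous.
under eq_fun do rewrite mkseqS quad_comp_rcons coefD expr2 coefM coefC.
apply: (@cvgD _ C); last by case: (i == 0%N); [exact: cf|exact: cvg_cst].
apply: (@cvg_big C _ _ _ _ (@add_continuous C)) => j _.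
by apply: (@cvgM C); exact: IH.
Qed.

End Coefficients.

Theorem proposition3p2 (R : realType) (n : nat) (n_ge1 : (1 <= n)%N) :
  compact [set coefs n p | p in @connectivity_locus R n] /\
  exists2 r : R, 0 < r & forall p : {poly Cplx R}, connectivity_locus n p ->
    filled_julia p `<=` ball (0 : Cplx R) r%:C.
Proof.
case: n n_ge1 => // n _.
have per2 (s : n.+1.-tuple (Cplx R)) :
    (forall j k, md (orb (shiftn j (per s)) k 0) <= 2) -> forall k, md (per s k) <= 2.
  by move=> h k; have := h k 1%N; rewrite /= expr0n add0r /shiftn addn0.
split; last first.
  (* The filled-in Julia sets lie in the closed disc of radius 2, hence in the open ball of radius
     3. *)
  exists 3 => // _ [[s _ <-]] cs z.
  have s0 : (0 < size s)%N by rewrite size_tuple.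
  move/(connected_filled_juliaP _ s0)/per2: cs => s2.
  rewrite (filled_julia_quad_comp _ 2 2) //; [|lra|rewrite expr2; lra].
  by move=> /(_ 0%N) /= z2; apply/ball_md; rewrite sub0r mdN; lra.
(* [inord] gives a junk entry for [i > n], but [mkseq] reads only the indices up to [n]. *)
pose f (v : 'rV[Cplx R]_n.+1) (i : nat) : Cplx R := v ord0 (inord i).
have cf i : continuous (f^~ i) by exact: coord_continuous.
pose S := [set v | forall j k, md (orb (shiftn j (per (mkseq (f v) n.+1))) k 0) <= 2].
have cS : closed S.
  have -> : S = \bigcap_j \bigcap_k
      [set v | md (orb (shiftn j (per (mkseq (f v) n.+1))) k 0) <= 2].
    by apply/seteqP; split=> [v h j _ k _|v h j k]; [exact: h|exact: (h j _ k)].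
  apply: closed_bigI => j _; apply: closed_bigI => k _; apply: closed_md_le.
  apply: orb_continuous => [i|]; last exact: cst_continuous.
  rewrite /shiftn /per; under eq_fun do rewrite size_mkseq nth_mkseq ?ltn_pmod //.
  exact: cf.
have kS : compact S.
  apply: (subclosed_compact cS
    (@rV_compact (Cplx R) n.+1 (fun=> [set z | md z <= 2]) (fun=> disc_compact 2))).
  move=> v h i; have := h i 1%N; rewrite /= expr0n add0r /shiftn addn0 /per size_mkseq.
  by rewrite modn_small // nth_mkseq // /f inord_val.
(* The locus is the image of the compact parameter set [S] under the coefficient map. *)
have -> : [set coefs n.+1 p | p in @connectivity_locus R n.+1] =
    (fun v => coefs n.+1 (quad_comp (mkseq (f v) n.+1))) @` S.
  apply/seteqP; split=> [_ [_ [[s _ <-] cs] <-]|_ [v Sv <-]]; last first.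
    exists (quad_comp (mkseq (f v) n.+1)) => //; split.
      by exists (Tuple (introT eqP (size_mkseq (f v) n.+1))).
    by apply/connected_filled_juliaP; rewrite ?size_mkseq.
  have s0 : (0 < size s)%N by rewrite size_tuple.
  have sE : mkseq (f (\row_i tnth s i)) n.+1 = s.
    apply: (@eq_from_nth _ 0); rewrite size_mkseq ?size_tuple // => i i_n.
    by rewrite nth_mkseq // /f mxE (tnth_nth 0) inordK.
  exists (\row_i tnth s i); last by rewrite sE.
  by rewrite /S /= sE; exact/(connected_filled_juliaP _ s0).
apply: continuous_compact kS; apply: continuous_subspaceT.
apply: matrix_continuous => i j.
rewrite /coefs; under eq_fun do rewrite mxE.
exact: coef_quad_comp_continuous.
Qed.
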